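(* Let $\Lambda$ be a rank-$3$ lattice in $\mathbb{E}^3$. If $\Lambda$ is preserved by the group $\tilde{\mathbf{D}}_3$, then there exists a diagonal transformation $D=\mathrm{diag}(a,a,b)$ such that $$\Lambda D^{-1}\in\left\{\Lambda^{\{3,6\}}_{(1,0)}\oplus e_3,\ \Lambda^{\{3,6\}}_{(1,1)}\oplus e_3,\ \Lambda^{\{3,6\}}_{(1,1)}\oplus(u_1+e_3),\ \Lambda^{\{3,6\}}_{(1,1)}\oplus(u_2+e_3)\right\}.$$
   Context: A rank-$d$ lattice is the set of integer linear combinations of $d$ linearly independent vectors of $\mathbb{E}^3$. $\{e_1,e_2,e_3\}$ is the standard basis, $o$ the origin, $u_1=e_1$ and $u_2=\frac12e_1+\frac{\sqrt3}{2}e_2$. $\tilde{\mathbf{D}}_3$ is the group of order $6$ generated by the reflection in the plane containing $o,u_1,e_3$ and the reflection in the plane containing $o,u_2,e_3$ (planes through the $z$-axis at angle $\frac{\pi}{3}$). A lattice is preserved by a group of linear isometries if every element of the group maps the lattice to itself. $\Lambda T=\{vT:v\in\Lambda\}$ for a linear map $T$; $\mathrm{diag}(a,a,b)$ is invertible. $\Lambda^{\{3,6\}}_{(1,0)}$ is the rank-$2$ lattice generated by $u_1,u_2$ and $\Lambda^{\{3,6\}}_{(1,1)}$ is the rank-$2$ lattice generated by $u_1+u_2$ and $2u_1-u_2$. For a lattice $\Lambda_0$ in a subspace $V$ and a vector $w\notin V$, $\Lambda_0\oplus w=\bigcup_{k\in\mathbb{Z}}(\Lambda_0+kw)$. *)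

(* Defs.v *)
(* The Euclidean space E^3 is 'rV[R]_3 over a realType R; linear maps are
   3 x 3 matrices acting on the right, v |-> v *m T, and e_1, e_2, e_3 are the
   basis vectors of indices 0, 1, 2. *)
From mathcomp Require Import all_boot all_order all_algebra.
From mathcomp Require Import boolp classical_sets reals.

Set Implicit Arguments.
Unset Strict Implicit.
Unset Printing Implicit Defensive.

Import Order.TTheory GRing.Theory Num.Theory.
Local Open Scope classical_set_scope.
Local Open Scope ring_scope.

Section Lattices.
Variable R : realType.
Implicit Types (u v w n : 'rV[R]_3) (T : 'M[R]_3) (L : set 'rV[R]_3).

Definition lattice_span d (B : d.-tuple 'rV[R]_3) : set 'rV[R]_3 :=
  [set v | exists k : 'I_d -> int, v = \sum_(i < d) tnth B i *~ k i].

Definition is_lattice (d : nat) L : Prop :=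
  exists2 B : d.-tuple 'rV[R]_3, free B & L = lattice_span B.

Definition lattice_img L T : set 'rV[R]_3 := [set v *m T | v in L].

Definition lattice_oplus L w : set 'rV[R]_3 :=
  \bigcup_(k : int) [set u + w *~ k | u in L].

Definition preserved_by L (G : set 'M[R]_3) : Prop :=
  forall T, G T -> lattice_img L T = L.

Definition dot u v : R := \sum_(i < 3) u 0 i * v 0 i.

Definition cross u v : 'rV[R]_3 :=
  \row_(i < 3) [:: u 0 1 * v 0 2 - u 0 2 * v 0 1;
                   u 0 2 * v 0 0 - u 0 0 * v 0 2;
                   u 0 0 * v 0 1 - u 0 1 * v 0 0 ]`_i.

(* v |-> v - 2 (v.n) / (n.n) n, the reflection in the plane orthogonal to n *)
Definition reflection n : 'M[R]_3 :=
  lin1_mx (fun v => v - (2 * dot v n / dot n n) *: n).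

(* the plane containing o, u and v, for linearly independent u and v *)
Definition plane_reflection u v : 'M[R]_3 := reflection (cross u v).

Definition isometry_group (G : set 'M[R]_3) : Prop :=
  [/\ forall T, G T -> T *m T^T = 1%:M,
      G 1%:M,
      forall S T, G S -> G T -> G (S *m T)
    & forall T, G T -> G (invmx T)].

Definition generated_isometry_group (S : set 'M[R]_3) : set 'M[R]_3 :=
  smallest isometry_group S.

Definition e1 : 'rV[R]_3 := delta_mx 0 0.
Definition e2 : 'rV[R]_3 := delta_mx 0 1.
Definition e3 : 'rV[R]_3 := delta_mx 0 2.

Definition u1 : 'rV[R]_3 := e1.
Definition u2 : 'rV[R]_3 := (1 / 2) *: e1 + (Num.sqrt 3 / 2) *: e2.

Definition D3_tilde : set 'M[R]_3 :=
  generated_isometry_group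
    [set plane_reflection u1 e3; plane_reflection u2 e3].

Definition diag3 (a b c : R) : 'M[R]_3 :=
  diag_mx (\row_(i < 3) [:: a; b; c]`_i).

Definition Lambda36_10 : set 'rV[R]_3 := lattice_span [tuple u1; u2].
Definition Lambda36_11 : set 'rV[R]_3 :=
  lattice_span [tuple u1 + u2; u1 *+ 2 - u2].

End Lattices.

Arguments e1 {R}.
Arguments e2 {R}.
Arguments e3 {R}.
Arguments u1 {R}.
Arguments u2 {R}.
Arguments D3_tilde {R}.
Arguments Lambda36_10 {R}.
Arguments Lambda36_11 {R}.

(* Main.v *)
From HB Require Import structures.
Require Import Defs.
From mathcomp Require Import all_boot all_order all_algebra.
From mathcomp Require Import boolp classical_sets reals.
From mathcomp Require Import ring lra zify.

(** The proof is carried out in the coordinates [p, q, z] of the vector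
    [p u1 + q u2 + z e3].  There the two generating reflections become the
    integral maps [(p, q, z) |-> (p + q, - q, z)] and
    [(p, q, z) |-> (- p, p + q, z)], and [diag (a, a, b)] multiplies [p] and
    [q] by [a] and [z] by [b], so that the square root of 3 disappears and the
    problem is about [trigonal] subgroups of the coordinate space.

    Two subgroups of the real line fix the scales: the multiples of [u1] in the
    lattice, and the heights [z] of its vectors.  Adding up images under the
    group turns a lattice vector into [3 p u1] and into [3 z e3]
    ([trigonal_triple_fst], [trigonal_triple_height]).  So the first subgroup is
    nonzero, and a vector on the vertical axis has three times any given
    height.  A lattice vector on a fixed line has integral coordinates in a
    lattice basis, which makes it an integral multiple of one vector of that
    line ([lattice_line]); hence both subgroups are cyclic.  Rescaling by their
    generators makes both of them equal to the integers.

    The horizontal vectors now contain the hexagonal lattice spanned by [u1]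
    and [u2].  Adding to a horizontal vector its mirror images shows that they
    lie in the lattice of index 3 above it, which is one third of the lattice
    spanned by [u1 + u2] and [2 u1 - u2].  As 3 is prime, the horizontal
    lattice is one or the other.
    - In the first case the difference between a vector and its mirror images
      is horizontal, which forces integral coordinates: all layers are
      vertical translates of the horizontal one ([trigonal_primitive]).
    - In the second case, rescaled by 3, the first layer is shifted by an
      integral vector modulo the horizontal lattice.  That quotient has order 3
      and representatives [0, u1, u2], which gives the three remaining
      lattices ([trigonal_centred]). *)

Set Implicit Arguments.
Unset Strict Implicit.
Unset Printing Implicit Defensive.

Import Order.TTheory GRing.Theory Num.Theory.
Local Open Scope classical_set_scope.
Local Open Scope ring_scope.

(** * Cyclic subgroups of the integers and of the real line *)

(** Euclidean division by the least positive element. *)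
Lemma int_subgroup_cyclic (A : set int) :
  A 0 -> (forall x y, A x -> A y -> A (x - y)) ->
  exists g, forall x, A x <-> exists k, x = k * g.
Proof.
move=> A0 AB.
have AN x : A x -> A (- x) by move=> Ax; rewrite -sub0r; apply: AB.
have AD x y : A x -> A y -> A (x + y).
  by move=> Ax Ay; rewrite -[y]opprK; apply: AB => //; apply: AN.
have AM k x : A x -> A (k * x).
  move=> Ax; elim: k => [|n IH|n IH]; first by rewrite mul0r.
    by rewrite intS mulrDl mul1r; apply: AD.
  by rewrite intS opprD mulrDl mulN1r; apply: AD => //; apply: AN.
have [[x [Ax x0]]|noA] := pselect (exists x, A x /\ x <> 0); last first.
  exists 0 => x; split=> [Ax|[k ->]]; last by rewrite mulr0.
  by exists 0; rewrite mulr0; apply: contrapT => x0; apply: noA; exists x.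
pose P n := `[< A n.+1%:Z >].
have exP : exists n, P n.
  exists `|x|%N.-1; apply/asboolP.
  have -> : `|x|%N.-1.+1%:Z = Num.sg x * x by lia.
  exact: AM.
case: (ex_minnP exP) => g /asboolP Ag gmin.
exists g.+1%:Z => y; split=> [Ay|[k ->]]; last exact: AM.
exists (y %/ g.+1%:Z)%Z.
have Ar : A (y %% g.+1%:Z)%Z by apply: AB => //; apply: AM.
have r0 : (0 <= y %% g.+1%:Z)%Z by rewrite modz_ge0.
have rg : ((y %% g.+1%:Z)%Z < g.+1%:Z) by rewrite ltz_pmod.
rewrite {1}(divz_eq y g.+1%:Z).
suff -> : (y %% g.+1%:Z)%Z = 0 by rewrite addr0.
apply: contrapT => rn0.
have := gmin `|(y %% g.+1%:Z)%Z|%N.-1; rewrite /P asboolE.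
have -> : `|(y %% g.+1%:Z)%Z|%N.-1.+1%:Z = (y %% g.+1%:Z)%Z by lia.
by move=> /(_ Ar); lia.
Qed.

Lemma mod3_balanced (m : int) :
  exists k, [\/ m = 3 * k, m = 3 * k + 1 | m = 3 * k - 1].
Proof.
have mE := divz_eq m 3; have r0 : (0 <= m %% 3)%Z by rewrite modz_ge0.
have r3 : (m %% 3)%Z < 3 by rewrite ltz_pmod.
have [r|[r|r]] : (m %% 3)%Z = 0 \/ (m %% 3)%Z = 1 \/ (m %% 3)%Z = 2 by lia.
- by exists (m %/ 3)%Z; constructor 1; lia.
- by exists (m %/ 3)%Z; constructor 2; lia.
- by exists ((m %/ 3)%Z + 1); constructor 3; lia.
Qed.

(** The form in which discreteness of a lattice is used: multiplication by the
    common denominator [c] turns [A] into a subgroup of the integers. *)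
Lemma commensurable_subgroup_cyclic (R : archiRealFieldType) (A : set R) c :
  c != 0 -> (forall x, A x -> x * c \is a Num.int) ->
  A 0 -> (forall x y, A x -> A y -> A (x - y)) ->
  (exists2 x, A x & x != 0) ->
  exists2 g, g != 0 & forall x, A (g * x) <-> x \is a Num.int.
Proof.
move=> c0 Ac A0 AB [y Ay y0].
have [||g Ag] := @int_subgroup_cyclic [set k | A (k%:~R / c)].
- by rewrite /= mul0r.
- by move=> j k /= Aj Ak; rewrite intrB mulrBl; apply: AB.
have gen x : A x -> exists k : int, x = k%:~R * (g%:~R / c).
  move=> Ax; have /intrP[n xn] := Ac x Ax.
  have [k nk] : exists k, n = k * g by apply/Ag; rewrite /= -xn mulfK.
  by exists k; rewrite mulrA -intrM -nk -xn mulfK.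
have g0 : g%:~R / c != 0.
  have [k yk] := gen y Ay.
  by apply: contraNneq y0 => g0; rewrite yk g0 mulr0.
exists (g%:~R / c) => // x; split=> [/gen[k]|/intrP[k ->]].
  by rewrite mulrC => /(mulIf g0) ->; apply/intrP; exists k.
have : A ((k * g)%:~R / c) by apply/Ag; exists k.
by rewrite intrM -mulrA mulrC.
Qed.

(** * Subgroups with trigonal symmetry in hexagonal coordinates *)

(** Additive subgroups invariant under the two reflections generating the
    group, expressed in the coordinates along [u1], [u2] and [e3]; the last
    two closure conditions are the mirrors through [u1] and [u2]. *)
Definition trigonal (R : archiRealFieldType) (M : R -> R -> R -> Prop) :=
  [/\ M 0 0 0,
      forall p q z p' q' z', M p q z -> M p' q' z' ->
        M (p - p') (q - q') (z - z'),
      forall p q z, M p q z -> M (p + q) (- q) z &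
      forall p q z, M p q z -> M (- p) (p + q) z].

Lemma trigonalD (R : archiRealFieldType) (M : R -> R -> R -> Prop)
    p q z p' q' z' : trigonal M ->
  M p q z -> M p' q' z' -> M (p + p') (q + q') (z + z').
Proof.
move=> [M0 MB _ _] Mv Mw; have := MB _ _ _ _ _ _ Mv (MB _ _ _ _ _ _ M0 Mw).
by rewrite !sub0r !opprK.
Qed.

Lemma trigonalM (R : archiRealFieldType) (M : R -> R -> R -> Prop)
    p q z k : trigonal M -> k \is a Num.int ->
  M p q z -> M (k * p) (k * q) (k * z).
Proof.
move=> tM + Mv => /intrP[n ->]; have [M0 MB _ _] := tM.
elim: n => [|n IH|n IH]; first by rewrite !mul0r.
  by rewrite intS intrD !mulrDl !mul1r; apply: trigonalD.
rewrite intS opprD intrD !mulrDl !mulrN1z !mulN1r ![- _ + _]addrC.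
exact: MB.
Qed.

(** The product of the two reflections is a rotation of order 3; it brings the
    second coordinate into first position. *)
Lemma trigonal_rot (R : archiRealFieldType) (M : R -> R -> R -> Prop)
    p q z : trigonal M -> M p q z -> M q (- p - q) z.
Proof.
move=> [_ _ M1 M2] Mv; have := M1 _ _ _ (M2 _ _ _ Mv).
by rewrite addKr opprD.
Qed.

(** Subtracting from a vector its image under the mirror through [u2] leaves
    [p (2 u1 - u2)], and adding to this its image under the mirror through [u1]
    leaves a vector on the axis of [u1]. *)
Lemma trigonal_triple_fst (R : archiRealFieldType) (M : R -> R -> R -> Prop)
    p q z : trigonal M -> M p q z -> M (3 * p) 0 0.
Proof.
move=> tM Mv; have [_ MB M1 M2] := tM.
have Mw := MB _ _ _ _ _ _ Mv (M2 _ _ _ Mv).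
have := trigonalD tM Mw (M1 _ _ _ Mw).
by congr (M _ _ _); ring.
Qed.

(** The three images of a vector under the rotations add up to a vertical
    vector. *)
Lemma trigonal_triple_height (R : archiRealFieldType) (M : R -> R -> R -> Prop)
    p q z : trigonal M -> M p q z -> M 0 0 (3 * z).
Proof.
move=> tM Mv; have Mv' := trigonal_rot tM Mv.
have := trigonalD tM (trigonalD tM Mv Mv') (trigonal_rot tM Mv').
by congr (M _ _ _); ring.
Qed.

Lemma trigonal_unit_lattice (R : archiRealFieldType) (M : R -> R -> R -> Prop)
    p q : trigonal M ->
  (forall x, M x 0 0 <-> x \is a Num.int) ->
  p \is a Num.int -> q \is a Num.int -> M p q 0.
Proof.
move=> tM MX pi qi; have [_ _ _ M2] := tM.
have := trigonalD tM ((MX (p + q)).2 (rpredD pi qi)) (M2 _ _ _ ((MX q).2 qi)).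
by congr (M _ _ _); ring.
Qed.

(** A horizontal vector plus its mirror image lies on the axis of [u1].  With
    [3 p] integral this confines horizontal vectors to a lattice containing the
    unit hexagonal lattice with index 3. *)
Lemma trigonal_axis_sum (R : archiRealFieldType) (M : R -> R -> R -> Prop)
    p q : trigonal M ->
  (forall x, M x 0 0 <-> x \is a Num.int) ->
  M p q 0 -> 2 * p + q \is a Num.int.
Proof.
move=> tM MX Mv; have [_ _ M1 _] := tM; apply/MX.
have := trigonalD tM Mv (M1 _ _ _ Mv).
by congr (M _ _ _); ring.
Qed.

(** When all horizontal vectors have integral coordinates, so has every vector
    [v], since the differences between [v] and its mirror images are
    horizontal; thus each layer contains a point of the vertical axis. *)
Lemma trigonal_primitive (R : archiRealFieldType) (M : R -> R -> R -> Prop) :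
  trigonal M ->
  (forall x, M x 0 0 <-> x \is a Num.int) ->
  (forall z, z \is a Num.int <-> exists p q, M p q z) ->
  (forall p q, M p q 0 -> p \is a Num.int) ->
  forall p q z, M p q z <->
    exists i j k : int, [/\ p = i%:~R, q = j%:~R & z = k%:~R].
Proof.
move=> tM MX MZ Mint; have [_ MB M1 M2] := tM.
have Mint' p q z : M p q z -> p \is a Num.int /\ q \is a Num.int.
  move=> Mv; split.
    have := MB _ _ _ _ _ _ (M2 _ _ _ Mv) Mv; rewrite subrr.
    move=> /(trigonal_rot tM)/Mint; congr (_ \is a _); ring.
  have := MB _ _ _ _ _ _ (M1 _ _ _ Mv) Mv; rewrite subrr.
  by move=> /Mint; congr (_ \is a _); ring.
move=> p q z; split=> [Mv|[i [j [k [-> -> ->]]]]].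
  have [/intrP[i ->] /intrP[j ->]] := Mint' _ _ _ Mv.
  have /intrP[k ->] : z \is a Num.int by apply/MZ; exists p, q.
  by exists i, j, k.
have [p' [q' Mt]] : exists p' q', M p' q' k%:~R by apply/MZ/intr_int.
have [p'i q'i] := Mint' _ _ _ Mt.
have Mh : M (i%:~R - p') (j%:~R - q') 0.
  by apply: trigonal_unit_lattice; rewrite ?rpredB ?intr_int.
by have := trigonalD tM Mh Mt; rewrite !subrK add0r.
Qed.

(** A horizontal vector outside the unit hexagonal lattice generates, modulo
    that lattice, the group of order 3 of the possible horizontal vectors; this
    group also contains the centre [(u1 + u2) / 3] of a triangle. *)
Lemma trigonal_centre (R : archiRealFieldType) (M : R -> R -> R -> Prop) :
  trigonal M ->
  (forall x, M x 0 0 <-> x \is a Num.int) ->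
  ~ (forall p q, M p q 0 -> p \is a Num.int) ->
  M (1 / 3) (1 / 3) 0.
Proof.
move=> tM MX nMint; have [_ MB _ _] := tM.
have [p [q [Mpq pNint]]] : exists p q, M p q 0 /\ p \isn't a Num.int.
  apply: contrapT => H; apply: nMint => p q Mpq; apply: contrapT => pN.
  by apply: H; exists p, q; split=> //; apply/negP.
have /intrP[m pm] : 3 * p \is a Num.int.
  by apply/MX; exact: trigonal_triple_fst Mpq.
have pE : p = m%:~R / 3 by rewrite -pm mulrC mulKf // pnatr_eq0.
have /intrP[n hn] := trigonal_axis_sum tM MX Mpq.
have [k [e [mE eE]]] : exists k e : int, m = 3 * k + e /\ (e = 1 \/ e = -1).
  have [k [mk|mk|mk]] := mod3_balanced m.
  - by move: pNint; rewrite pE mk intrM mulrC mulKf ?pnatr_eq0 // intr_int.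
  - by exists k, 1; split; last by left.
  - by exists k, (-1); split; last by right.
(* p = k + e / 3, and 2 p + q = n then gives q = n - 2 k - e + e / 3, so that
   this subtraction leaves e times the centre. *)
have kn : M (p - k%:~R) (q - (n - 2 * k - e)%:~R) 0.
  rewrite -(subrr 0); apply: MB => //.
  by apply: trigonal_unit_lattice => //; exact: intr_int.
have qE : q = n%:~R - 2 * p by rewrite -hn; ring.
have := trigonalM (k := e%:~R) tM (intr_int _ _) kn.
rewrite qE pE mE; case: eE => ->; congr (M _ _ _);
  by rewrite ?rmorphB ?rmorphD ?rmorphM /=; field.
Qed.

(** Here [p / 3] and [q / 3] rescale the horizontal lattice to the one spanned
    by [u1 + u2] and [2 u1 - u2], which consists of the integral vectors with
    [p - q] divisible by 3.  The layer at height 1 is a translate of it by an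
    integral vector, and [p - q] modulo 3 decides which of [0], [u1] and [u2]
    can be taken as translation [ed]. *)
Lemma trigonal_centred (R : archiRealFieldType) (M : R -> R -> R -> Prop) :
  trigonal M ->
  (forall x, M x 0 0 <-> x \is a Num.int) ->
  (forall z, z \is a Num.int <-> exists p q, M p q z) ->
  ~ (forall p q, M p q 0 -> p \is a Num.int) ->
  exists2 ed : R * R, ed \in [:: (0, 0); (1, 0); (0, 1)] &
  forall p q z, M (p / 3) (q / 3) z <->
    exists i j k : int, [/\ p = (i + 2 * j)%:~R + ed.1 * k%:~R,
      q = (i - j)%:~R + ed.2 * k%:~R & z = k%:~R].
Proof.
move=> tM MX MZ nMint; have [_ MB _ _] := tM.
have Mint3 p q z : M (p / 3) q z -> p \is a Num.int.
  by move=> /(trigonal_triple_fst tM)/MX; rewrite mulrC divfK // pnatr_eq0.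
have Mcentre := trigonal_centre tM MX nMint.
have Mh i j : M ((i + 2 * j)%:~R / 3) ((i - j)%:~R / 3) 0.
  have Mj : M j%:~R 0 0 by apply/MX/intr_int.
  have Mij := trigonalM (k := (i - j)%:~R) tM (intr_int _ _) Mcentre.
  have := trigonalD tM Mij Mj.
  by rewrite ?rmorphB ?rmorphD ?rmorphM /=; congr (M _ _ _); field.
have hM p' q' : M (p' / 3) (q' / 3) 0 ->
    exists i j : int, p' = (i + 2 * j)%:~R /\ q' = (i - j)%:~R.
  move=> Mv; have /intrP[m pm] := Mint3 _ _ _ Mv.
  have /intrP[l ql] := Mint3 _ _ _ (trigonal_rot tM Mv).
  have /intrP[n hn] := trigonal_axis_sum tM MX Mv.
  have mln : 2 * m + l = 3 * n.
    apply/eqP; rewrite -(eqr_int R) !rmorphD !rmorphM /= -hn -pm -ql.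
    by apply/eqP; field.
  exists (l + m - n), (m - n).
  by split; [rewrite pm|rewrite ql]; congr (_%:~R); lia.
have [p1 [q1 Mt]] : exists p q, M p q 1 by apply/MZ/rpred1.
have /intrP[m pm] : 3 * p1 \is a Num.int.
  by apply/MX; exact: trigonal_triple_fst Mt.
have /intrP[l ql] : 3 * q1 \is a Num.int.
  by apply/MX; exact: trigonal_triple_fst (trigonal_rot tM Mt).
(* u2 stands for the residue -1 of p - q modulo 3. *)
have [n [[e d] /= edin mlE]] : exists n : int, exists2 ed : int * int,
    ed \in [:: (0, 0); (1, 0); (0, 1)] & m - l = 3 * n + ed.1 - ed.2.
  have [k [mk|mk|mk]] := mod3_balanced (m - l); exists k.
  - by exists (0, 0) => //=; lia.
  - by exists (1, 0) => //=; lia.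
  - by exists (0, 1) => //=; lia.
(* The shift (m - e, l - d) has difference divisible by 3, that is, it is a
   combination of (1, 1) and (2, -1) with the coefficients used below. *)
have Med : M (e%:~R / 3) (d%:~R / 3) 1.
  have := MB _ _ _ _ _ _ Mt (Mh (l - d + n) n).
  have -> : l - d + n + 2 * n = m - e by lia.
  have -> : l - d + n - n = l - d by lia.
  by rewrite !rmorphB /= -pm -ql; congr (M _ _ _); field.
pose ed : R * R := (e%:~R, d%:~R).
exists ed.
  by move: edin; rewrite /ed !inE => /or3P[] /eqP[-> ->]; rewrite eqxx ?orbT.
move=> p' q' z /=; split=> [Mv|[i [j [k [-> -> ->]]]]].
  have /intrP[k zk] : z \is a Num.int by apply/MZ; exists (p' / 3), (q' / 3).
  have := MB _ _ _ _ _ _ Mv (trigonalM (k := k%:~R) tM (intr_int _ _) Med).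
  rewrite mulr1 zk subrr !mulrA -!mulrBl => /hM[i [j [pE qE]]].
  by exists i, j, k; rewrite -pE -qE ![_ * k%:~R]mulrC !subrK.
have := trigonalD tM (Mh i j) (trigonalM (k := k%:~R) tM (intr_int _ _) Med).
by congr (M _ _ _); field.
Qed.

(** * Hexagonal coordinates and the mirror reflections *)

Definition hexpoint (R : realType) (p q z : R) : 'rV[R]_3 :=
  p *: u1 + q *: u2 + z *: e3.

Lemma hexpointB (R : realType) (p q z p' q' z' : R) :
  hexpoint (p - p') (q - q') (z - z') = hexpoint p q z - hexpoint p' q' z'.
Proof. by apply/rowP => i; rewrite !mxE; ring. Qed.

Lemma sqrt3_neq0 (R : realType) : Num.sqrt (3 : R) != 0.
Proof. by rewrite sqrtr_eq0 -ltNge ltr0n. Qed.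

Lemma row3P (R : realType) (v w : 'rV[R]_3) :
  v 0 0 = w 0 0 -> v 0 1 = w 0 1 -> v 0 2 = w 0 2 -> v = w.
Proof.
move=> h0 h1 h2; apply/rowP => i.
by case: i => [[|[|[|//]]] hi]; [move: h0|move: h1|move: h2];
  congr (v _ _ = w _ _); apply/val_inj.
Qed.

Lemma hexpointE (R : realType) (p q z : R) :
  [/\ hexpoint p q z 0 0 = p + q / 2,
      hexpoint p q z 0 1 = q * (Num.sqrt 3 / 2)
    & hexpoint p q z 0 2 = z].
Proof.
by split; rewrite /hexpoint /u1 /u2 /e1 /e2 /e3 !mxE /=; ring.
Qed.

Lemma hexpoint_surj (R : realType) (v : 'rV[R]_3) :
  exists p q z, v = hexpoint p q z.
Proof.
have s0 := sqrt3_neq0 R.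
pose q := v 0 1 / (Num.sqrt 3 / 2).
exists (v 0 0 - q / 2), q, (v 0 2).
have [h0 h1 h2] := hexpointE (v 0 0 - q / 2) q (v 0 2).
by apply: row3P; rewrite ?h0 ?h1 ?h2 ?subrK // /q; field.
Qed.

(** The formula defining [reflection] is linear, so that the matrix represents
    it on all vectors, not only on the basis vectors. *)
Lemma mulmx_reflection (R : realType) (n v : 'rV[R]_3) :
  v *m reflection n = v - (2 * dot v n / dot n n) *: n.
Proof.
pose f w : 'rV[R]_3 := w - (2 * dot w n / dot n n) *: n.
have dotD (a : R) u w : dot (a *: u + w) n = a * dot u n + dot w n.
  rewrite /dot mulr_sumr -big_split; apply: eq_bigr => i _.
  by rewrite !mxE mulrDl mulrA.
have f_linear : linear f.
  move=> a u w; apply/rowP => i; rewrite /f dotD !mxE; ring.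
pose F : {linear 'rV[R]_3 -> 'rV[R]_3} :=
  HB.pack f (GRing.isLinear.Build _ _ _ _ f f_linear).
exact: (mul_rV_lin1 F).
Qed.

Lemma dotE (R : realType) (v w : 'rV[R]_3) :
  dot v w = v 0 0 * w 0 0 + v 0 1 * w 0 1 + v 0 2 * w 0 2.
Proof.
rewrite /dot !big_ord_recl big_ord0 addr0 addrA.
by congr (_ * _ + _ * _ + _ * _); congr (_ 0 _); apply/val_inj.
Qed.

Lemma cross_u1_e3 (R : realType) :
  [/\ cross (@u1 R) e3 0 0 = 0, cross (@u1 R) e3 0 1 = -1
    & cross (@u1 R) e3 0 2 = 0].
Proof. by split; rewrite !mxE /=; ring. Qed.

Lemma cross_u2_e3 (R : realType) :
  [/\ cross (@u2 R) e3 0 0 = Num.sqrt 3 / 2, cross (@u2 R) e3 0 1 = - (1 / 2)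
    & cross (@u2 R) e3 0 2 = 0].
Proof. by split; rewrite !mxE /=; ring. Qed.

Lemma reflection_u1_e3 (R : realType) (p q z : R) :
  hexpoint p q z *m plane_reflection u1 e3 = hexpoint (p + q) (- q) z.
Proof.
rewrite mulmx_reflection.
have [v0 v1 v2] := hexpointE p q z.
have [w0 w1 w2] := hexpointE (p + q) (- q) z.
have [n0 n1 n2] := cross_u1_e3 R.
apply: row3P; rewrite mxE [X in _ + X]mxE [X in _ - X]mxE
  ?w0 ?w1 ?w2 !dotE ?n0 ?n1 ?n2 ?v0 ?v1 ?v2; by field.
Qed.

Lemma reflection_u2_e3 (R : realType) (p q z : R) :
  hexpoint p q z *m plane_reflection u2 e3 = hexpoint (- p) (p + q) z.
Proof.
rewrite mulmx_reflection.
have [v0 v1 v2] := hexpointE p q z.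
have [w0 w1 w2] := hexpointE (- p) (p + q) z.
have [n0 n1 n2] := cross_u2_e3 R.
have s2 : Num.sqrt 3 ^+ 2 = 3 :> R by rewrite sqr_sqrtr ?ler0n.
have nn : dot (cross (@u2 R) e3) (cross u2 e3) = 1.
  by rewrite dotE n0 n1 n2 -!expr2 exprMn s2; field.
apply: row3P; rewrite mxE [X in _ + X]mxE [X in _ - X]mxE nn
  ?w0 ?w1 ?w2 !dotE ?n0 ?n1 ?n2 ?v0 ?v1 ?v2; by field: s2.
Qed.

(** * Lattices in hexagonal coordinates *)

Definition in_coords (R : realType) (L : set 'rV[R]_3) p q z :=
  L (hexpoint p q z).

Lemma lattice_span0 (R : realType) d (B : d.-tuple 'rV[R]_3) : lattice_span B 0.
Proof. by exists (fun=> 0); rewrite big1 // => i _; rewrite mulr0z. Qed.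

Lemma lattice_spanB (R : realType) d (B : d.-tuple 'rV[R]_3) v w :
  lattice_span B v -> lattice_span B w -> lattice_span B (v - w).
Proof.
move=> [k ->] [l ->]; exists (fun i => k i - l i).
by rewrite -sumrB; apply: eq_bigr => i _; rewrite mulrzBr.
Qed.

Lemma trigonal_lattice (R : realType) (L : set 'rV[R]_3) d :
  is_lattice d L -> preserved_by L D3_tilde -> trigonal (in_coords L).
Proof.
move=> [B _ LB] LD; rewrite /in_coords.
have LT T v : D3_tilde T -> L v -> L (v *m T).
  by move=> DT Lv; rewrite -(LD T DT); exists v.
split.
- rewrite /hexpoint !scale0r !addr0 LB; exact: lattice_span0.
- by move=> p q z p' q' z'; rewrite hexpointB LB; exact: lattice_spanB.
- move=> p q z Lv; rewrite -reflection_u1_e3; apply: LT => //.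
  by move=> G [_]; apply; left.
- move=> p q z Lv; rewrite -reflection_u2_e3; apply: LT => //.
  by move=> G [_]; apply; right.
Qed.

Lemma free_basis_fullv (R : realType) (B : 3.-tuple 'rV[R]_3) :
  free B -> basis_of fullv B.
Proof. by move=> fB; rewrite basisEfree fB subvf dimvf /dim /= size_tuple. Qed.

(** Some coordinate of [e] in the lattice basis is nonzero, and the multiple
    [x *: e] belongs to the lattice only if [x] times this coordinate is an
    integer. *)
Lemma lattice_line (R : realType) (B : 3.-tuple 'rV[R]_3) e :
  free B -> e != 0 -> exists2 c, c != 0 &
    forall x, lattice_span B (x *: e) -> x * c \is a Num.int.
Proof.
move=> fB e0; have bB := free_basis_fullv fB.
have [c c0] : exists i, coord B i e != 0.
  apply: contrapT => noc; move: e0.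
  rewrite (coord_basis bB (memvf e)) big1 ?eqxx //.
  move=> i _; suff /eqP-> : coord B i e == 0 by rewrite scale0r.
  by apply: contrapT => /negP ci; apply: noc; exists i.
exists (coord B c e) => // x [k xe].
have <- : coord B c (x *: e) = x * coord B c e by rewrite linearZ.
rewrite xe.
have -> : \sum_(i < 3) tnth B i *~ k i = \sum_(i < 3) (k i)%:~R *: B`_i.
  by apply: eq_bigr => i _; rewrite scaler_int (tnth_nth 0).
by rewrite coord_sum_free // intr_int.
Qed.

(** Otherwise the vectors of the basis, hence all vectors, would have zero
    [i]-th coordinate. *)
Lemma lattice_not_in_plane (R : realType) (B : 3.-tuple 'rV[R]_3) i :
  free B -> exists2 v, lattice_span B v & v 0 i != 0.
Proof.
move=> fB; apply: contrapT => noB.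
have B0 j : B`_j 0 i = 0.
  have [j3|j3] := ltnP j 3; last by rewrite nth_default ?size_tuple ?mxE.
  apply: contrapT => /eqP Bj; apply: noB; exists B`_j => //.
  exists (fun l => (l == Ordinal j3)%:Z); rewrite (bigD1 (Ordinal j3)) //= eqxx.
  rewrite big1 ?addr0 ?mulr1z ?(tnth_nth 0) // => l /negPf ->; exact: mulr0z.
have := coord_basis (free_basis_fullv fB) (memvf (delta_mx 0 i)).
move/(congr1 (fun v : 'rV_3 => v 0 i)); rewrite summxE mxE !eqxx big1.
  by move/eqP; rewrite oner_eq0.
by move=> j _; rewrite mxE B0 mulr0.
Qed.

Lemma hexpoint_diag3 (R : realType) (p q z a b : R) :
  hexpoint p q z *m diag3 a a b = hexpoint (a * p) (a * q) (b * z).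
Proof.
have [v0 v1 v2] := hexpointE p q z.
have [w0 w1 w2] := hexpointE (a * p) (a * q) (b * z).
by apply: row3P; rewrite mul_mx_diag !mxE ?v0 ?v1 ?v2 ?w0 ?w1 ?w2 /=; ring.
Qed.

Lemma diag3_unit (R : realType) (a b : R) :
  a != 0 -> b != 0 -> diag3 a a b \in unitmx.
Proof.
move=> a0 b0; rewrite unitmxE det_diag unitfE !big_ord_recl big_ord0 !mxE /=.
by rewrite !mulf_neq0 ?oner_eq0.
Qed.

Lemma lattice_imgV (R : realType) (L : set 'rV[R]_3) T v : T \in unitmx ->
  lattice_img L (invmx T) v <-> L (v *m T).
Proof.
move=> uT; split=> [[w Lw <-]|Lv]; first by rewrite mulmxKV.
by exists (v *m T); rewrite ?mulmxK.
Qed.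

Lemma lattice_oplus2P (R : realType) (f g w v : 'rV[R]_3) :
  lattice_oplus (lattice_span [tuple f; g]) w v <->
  exists i j k : int, v = f *~ i + g *~ j + w *~ k.
Proof.
split=> [[k _ [_ [c ->] <-]]|[i [j [k ->]]]].
  exists (c 0), (c 1), k; rewrite !big_ord_recl big_ord0 addr0.
  by congr (_ *~ c _ + _ *~ c _ + _); apply/val_inj.
exists k => //; exists (f *~ i + g *~ j) => //.
exists (fun l : 'I_2 => if l == 0 then i else j).
by rewrite !big_ord_recl big_ord0 addr0.
Qed.

Lemma hexpoint_inj (R : realType) (p q z p' q' z' : R) :
  hexpoint p q z = hexpoint p' q' z' -> [/\ p = p', q = q' & z = z'].
Proof.
have [v0 v1 v2] := hexpointE p q z; have [w0 w1 w2] := hexpointE p' q' z'.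
move=> vw; move: w0 w1 w2; rewrite -vw v0 v1 v2 => pE qE zE.
have s2 : Num.sqrt 3 / 2 != 0 :> R.
  by rewrite mulf_neq0 ?sqrt3_neq0 ?invr_eq0 ?pnatr_eq0.
have {}qE := mulIf s2 qE; split=> //.
by move: pE; rewrite qE => /addIr.
Qed.

Lemma Lambda36_10_oplusP (R : realType) (p q z : R) :
  lattice_oplus Lambda36_10 e3 (hexpoint p q z) <->
  exists i j k : int, [/\ p = i%:~R, q = j%:~R & z = k%:~R].
Proof.
have E (i j k : int) : u1 *~ i + u2 *~ j + e3 *~ k =
    hexpoint (i%:~R : R) j%:~R k%:~R by rewrite /hexpoint !scaler_int.
split=> [/lattice_oplus2P[i [j [k]]]|[i [j [k [-> -> ->]]]]].
  by rewrite E => /hexpoint_inj; exists i, j, k.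
by apply/lattice_oplus2P; exists i, j, k; rewrite E.
Qed.

Lemma Lambda36_11_oplusP (R : realType) (e d p q z : R) :
  lattice_oplus Lambda36_11 (e *: u1 + d *: u2 + e3) (hexpoint p q z) <->
  exists i j k : int, [/\ p = (i + 2 * j)%:~R + e * k%:~R,
    q = (i - j)%:~R + d * k%:~R & z = k%:~R].
Proof.
have E (i j k : int) : (u1 + u2) *~ i + (u1 *+ 2 - u2) *~ j +
    (e *: u1 + d *: u2 + e3) *~ k =
    hexpoint ((i + 2 * j)%:~R + e * k%:~R) ((i - j)%:~R + d * k%:~R) k%:~R.
  rewrite -!scaler_int -scaler_nat; apply/rowP => l.
  by rewrite /hexpoint rmorphB rmorphD rmorphM /= !mxE; ring.
split=> [/lattice_oplus2P[i [j [k]]]|[i [j [k [-> -> ->]]]]].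
  by rewrite E => /hexpoint_inj; exists i, j, k.
by apply/lattice_oplus2P; exists i, j, k; rewrite E.
Qed.

Lemma lattice_img_eq (R : realType) (L K : set 'rV[R]_3) (a b : R) :
  a != 0 -> b != 0 ->
  (forall p q z, in_coords L (a * p) (a * q) (b * z) <-> K (hexpoint p q z)) ->
  diag3 a a b \in unitmx /\ lattice_img L (invmx (diag3 a a b)) = K.
Proof.
move=> a0 b0 LK; have uD := diag3_unit a0 b0; split=> //.
apply/predeqP => v; have [p [q [z ->]]] := hexpoint_surj v.
by rewrite -LK (propext (lattice_imgV _ _ uD)) hexpoint_diag3.
Qed.

Lemma trigonal_scale (R : realType) (M : R -> R -> R -> Prop) (a b : R) :
  trigonal M -> trigonal (fun p q z => M (a * p) (a * q) (b * z)).
Proof.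
move=> [M0 MB M1 M2]; split=> [|p q z p' q' z'|p q z|p q z].
- by rewrite !mulr0.
- by rewrite !mulrBr; exact: MB.
- by rewrite mulrDr mulrN; exact: M1.
- by rewrite mulrDr mulrN; exact: M2.
Qed.

(** * Normalization of the scales and the classification *)

(** The generator of the multiples of [u1] in the lattice.  A lattice vector
    with nonzero [e1]-coordinate [p + q / 2] has [p] or [q] nonzero, and both
    [3 p u1] and [3 q u1] are in the lattice. *)
Lemma lattice_axis_scale (R : realType) (L : set 'rV[R]_3) :
  is_lattice 3 L -> trigonal (in_coords L) ->
  exists2 a, a != 0 & forall x, in_coords L (a * x) 0 0 <-> x \is a Num.int.
Proof.
move=> [B fB LB] tM; have [M0 MB _ _] := tM.
have u1N0 : @u1 R != 0.
  by apply/eqP => /rowP/(_ 0)/eqP; rewrite !mxE oner_eq0.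
have [c c0 cint] := lattice_line fB u1N0.
apply: (@commensurable_subgroup_cyclic _ (fun x => in_coords L x 0 0) c) => //.
- move=> x; rewrite /in_coords /hexpoint !scale0r !addr0 LB; exact: cint.
- by move=> x y Mx My; have := MB _ _ _ _ _ _ Mx My; rewrite !subrr.
have [v Lv v0] := lattice_not_in_plane 0 fB.
move: Lv v0; have [p [q [z ->]]] := hexpoint_surj v; rewrite -LB => Mv.
have [-> _ _] := hexpointE p q z.
have [->|p0 _] := eqVneq p 0; last first.
  exists (3 * p); first exact: trigonal_triple_fst Mv.
  by rewrite mulf_neq0 ?pnatr_eq0.
rewrite add0r mulf_eq0 negb_or => /andP[q0 _].
exists (3 * q); last by rewrite mulf_neq0 ?pnatr_eq0.
exact: trigonal_triple_fst (trigonal_rot tM Mv).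
Qed.

(** The generator of the heights of lattice vectors: three times a height is
    the height of a lattice vector on the axis, so [lattice_line] bounds the
    denominators. *)
Lemma lattice_height_scale (R : realType) (L : set 'rV[R]_3) :
  is_lattice 3 L -> trigonal (in_coords L) ->
  exists2 b, b != 0 &
    forall z, (exists p q, in_coords L p q (b * z)) <-> z \is a Num.int.
Proof.
move=> [B fB LB] tM; have [M0 MB _ _] := tM.
have e3N0 : @e3 R != 0.
  by apply/eqP => /rowP/(_ 2)/eqP; rewrite !mxE oner_eq0.
have [c c0 cint] := lattice_line fB e3N0.
apply: (@commensurable_subgroup_cyclic _
  (fun z => exists p q, in_coords L p q z) (3 * c)).
- by rewrite mulf_neq0 ?pnatr_eq0.
- move=> z [p [q /(trigonal_triple_height tM)]].
  rewrite /in_coords /hexpoint !scale0r !add0r LB => /cint.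
  by congr (_ \is a _); ring.
- by exists 0, 0.
- move=> x y [p [q Mx]] [p' [q' My]]; exists (p - p'), (q - q').
  exact: MB.
have [v Lv v2] := lattice_not_in_plane 2 fB.
move: Lv v2; have [p [q [z ->]]] := hexpoint_surj v; rewrite -LB => Mv.
by have [_ _ ->] := hexpointE p q z; exists z => //; exists p, q.
Qed.

Theorem lemma4p7 (R : realType) (L : set 'rV[R]_3)
    (hL : is_lattice 3 L) (hD3 : preserved_by L D3_tilde) :
  exists a b : R, diag3 a a b \in unitmx /\
    [set lattice_oplus Lambda36_10 e3;
         lattice_oplus Lambda36_11 e3;
         lattice_oplus Lambda36_11 (u1 + e3);
         lattice_oplus Lambda36_11 (u2 + e3)]
      (lattice_img L (invmx (diag3 a a b))).
Proof.
have tL := trigonal_lattice hL hD3.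
have [a a0 La] := lattice_axis_scale hL tL.
have [b b0 Lb] := lattice_height_scale hL tL.
pose M p q z := in_coords L (a * p) (a * q) (b * z).
have tM : trigonal M by exact: trigonal_scale.
have MX x : M x 0 0 <-> x \is a Num.int by rewrite /M !mulr0.
have MZ z : z \is a Num.int <-> exists p q, M p q z.
  rewrite -Lb; split=> [[p [q Mv]]|[p [q Mv]]]; last by exists (a * p), (a * q).
  by exists (a^-1 * p), (a^-1 * q); rewrite /M !mulVKf.
have [Mint|nMint] := pselect (forall p q, M p q 0 -> p \is a Num.int).
  have LK p q z : M p q z <-> lattice_oplus Lambda36_10 e3 (hexpoint p q z).
    by rewrite Lambda36_10_oplusP; exact: trigonal_primitive.
  have [uD LE] := lattice_img_eq a0 b0 LK; exists a, b.
  by rewrite LE; split=> //; left; left; left.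
have [[e d] /= edin Med] := trigonal_centred tM MX MZ nMint.
have a30 : a / 3 != 0 by rewrite mulf_neq0 ?invr_eq0 ?pnatr_eq0.
have LK p q z : in_coords L (a / 3 * p) (a / 3 * q) (b * z) <->
    lattice_oplus Lambda36_11 (e *: u1 + d *: u2 + e3) (hexpoint p q z).
  by rewrite Lambda36_11_oplusP -Med /M -!mulrA ![3^-1 * _]mulrC.
have [uD LE] := lattice_img_eq a30 b0 LK; exists (a / 3), b; rewrite LE.
split=> //; move: edin; rewrite !inE => /or3P[] /eqP[-> ->];
  rewrite !(scale0r, scale1r, add0r, addr0).
- by left; left; right.
- by left; right.
- by right.
Qed.
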